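(* For every integer $\ell\ge1$, every instance, and every output $\pi$ of the capacity-scaling algorithm, $$\frac{2^{\ell+2}}{2^{\ell}-1}\, p\bigl(\textsc{Alg}(B+(4\ell-1)\chi)\bigr)\ \ge\ p(\textsc{Opt}(B))\quad\text{for all } B\in\mathbb{R}_{\ge0},$$ i.e., the capacity-scaling algorithm is $\bigl((4\ell-1)\chi,\frac{2^{\ell+2}}{2^\ell-1}\bigr)$-competitive.
   Context: An instance consists of a finite undirected graph $G=(V,E)$, edge costs $c(e)>0$, vertex prizes $p(v)\ge0$ and a root $r\in V$. For a subgraph $G'=(V',E')$, $p(G')=\sum_{v\in V'}p(v)$, $c(G')=\sum_{e\in E'}c(e)$. A rooted subtree is a subtree of $G$ containing $r$; $\mathcal T$ is the set of rooted subtrees. For $B\ge0$, $\textsc{Opt}(B)$ is a rooted subtree maximizing $p(T)$ subject to $c(T)\le B$. Let $V^*=\{v:p(v)>0\}$. An incremental solution is a sequence $\pi=(e_1,\dots,e_l)$ of distinct edges such that every prefix, together with $r$, forms a rooted subtree and the whole sequence spans $V^*$; $\textsc{Alg}(B)$ is the rooted subtree formed by $r$ and the edges $e_i$ of the output with $\sum_{j\le i}c(e_j)\le B$. An algorithm is $(\alpha,\mu)$-competitive if for every instance $\mu\,p(\textsc{Alg}(B+\alpha))\ge p(\textsc{Opt}(B))$ for all $B\ge 0$. Root eccentricity: $\chi=\max_v\ell(v)$ with $\ell(v)$ the minimum cost of an $r$-$v$ path. Density-greedy algorithm for trees (input: a tree $H$ with root $r$): for a rooted subtree $T$ with at least one edge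 let $d(T)=p(T)/c(T)$ (trivial tree: density 0); a min-max subtree is an inclusion-minimal rooted subtree of maximum density; for a rooted subtree $\overline T$, $H/\overline T$ is obtained by contracting $\overline T$ into $r$ (root prize set to $0$, other prizes and costs unchanged). Start with $\pi=()$, $\overline T=(\{r\},\emptyset)$; while $H/\overline T$ has nonzero total prize, choose any min-max subtree $T^*$ of $H/\overline T$, append to $\pi$ the edge of $H$ corresponding to the unique edge of $T^*$ incident to $r$, and add it to $\overline T$; output $\pi$. Capacity-scaling algorithm: $i=0$, $\pi=()$; while $\pi$ does not span all vertices of $V^*$: let $T_i\in\arg\max\{p(T):T\in\mathcal T, c(T)\le 2^i\chi\}$ (arbitrary maximizer), run the density-greedy algorithm for trees on $T_i$ with root $r$ to obtain $\pi_i$, append $\pi_i$ to $\pi$ while skipping edges already in $\pi$, edges parallel to edges already in $\pi$, and edges that would close a cycle with the edges already in $\pi$; set $i=i+1$. Output $\pi$. *)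

(* Defs.v *)
From HB Require Import structures.
From mathcomp Require Import all_boot all_order all_algebra.

Set Implicit Arguments.
Unset Strict Implicit.
Unset Printing Implicit Defensive.

Import Order.TTheory GRing.Theory Num.Theory.
Local Open Scope ring_scope.

(* A finite undirected rooted graph with edge costs and vertex prizes.  The
   vertex and edge sets are subsets of ambient finite types, so that subtrees
   and contractions of a graph are again graphs over the same types and every
   edge keeps its identity.  [ends e] is an unordered pair: all notions below
   are invariant under swapping it.  Parallel edges and loops are permitted. *)
Record graph (R : realFieldType) (V E : finType) := Graph {
  verts : {set V};
  edges : {set E};
  ends : E -> V * V;
  cost : E -> R;
  prize : V -> R;
  rootv : V }.

Record instance (R : realFieldType) (V E : finType) (G : graph R V E) : Prop :=
  Instance {
  root_in : rootv G \in verts G;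
  ends_in : forall e, e \in edges G ->
    ((ends G e).1 \in verts G) /\ ((ends G e).2 \in verts G);
  cost_gt0 : forall e, e \in edges G -> 0 < cost G e;
  prize_ge0 : forall v, v \in verts G -> 0 <= prize G v }.

Definition joins (R : realFieldType) (V E : finType) (G : graph R V E)
    (e : E) (x y : V) : bool :=
  (ends G e == (x, y)) || (ends G e == (y, x)).

(* A walk from [x] using edges of [A], given by its successive steps: the edge
   traversed and the vertex reached. *)
Fixpoint walk (R : realFieldType) (V E : finType) (G : graph R V E)
    (A : {set E}) (x : V) (w : seq (E * V)) : bool :=
  if w is (e, y) :: w' then [&& e \in A, joins G e x y & walk G A y w']
  else true.

Definition walk_end (V E : finType) (x : V) (w : seq (E * V)) : V :=
  last x (unzip2 w).

(* A loop is a cycle of length 1, two parallel edges form a cycle of length 2. *)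
Definition is_cycle (R : realFieldType) (V E : finType) (G : graph R V E)
    (A : {set E}) (x : V) (w : seq (E * V)) : Prop :=
  [/\ w <> [::], walk G A x w, walk_end x w = x,
      uniq (unzip1 w) & uniq (unzip2 w)].

Definition is_path (R : realFieldType) (V E : finType) (G : graph R V E)
    (x y : V) (w : seq (E * V)) : Prop :=
  [/\ walk G (edges G) x w, walk_end x w = y & uniq (x :: unzip2 w)].

Definition subgraph (V E : finType) : Type := ({set V} * {set E})%type.

Definition is_subgraph (R : realFieldType) (V E : finType) (G : graph R V E)
    (S : subgraph V E) : Prop :=
  [/\ S.1 \subset verts G, S.2 \subset edges G &
      forall e, e \in S.2 ->
        ((ends G e).1 \in S.1) /\ ((ends G e).2 \in S.1)].

Definition connected (R : realFieldType) (V E : finType) (G : graph R V E)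
    (S : subgraph V E) : Prop :=
  forall x y, x \in S.1 -> y \in S.1 ->
    exists2 w, walk G S.2 x w & walk_end x w = y.

Definition acyclic (R : realFieldType) (V E : finType) (G : graph R V E)
    (S : subgraph V E) : Prop :=
  forall x w, ~ is_cycle G S.2 x w.

Definition rooted_subtree (R : realFieldType) (V E : finType)
    (G : graph R V E) (S : subgraph V E) : Prop :=
  [/\ is_subgraph G S, rootv G \in S.1, connected G S & acyclic G S].

Definition prize_of (R : realFieldType) (V E : finType) (G : graph R V E)
    (S : subgraph V E) : R := \sum_(v in S.1) prize G v.

Definition cost_of (R : realFieldType) (V E : finType) (G : graph R V E)
    (S : subgraph V E) : R := \sum_(e in S.2) cost G e.

Definition is_opt (R : realFieldType) (V E : finType) (G : graph R V E)
    (B : R) (T : subgraph V E) : Prop :=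
  [/\ rooted_subtree G T, cost_of G T <= B &
      forall T', rooted_subtree G T' -> cost_of G T' <= B ->
        prize_of G T' <= prize_of G T].

Definition is_dist (R : realFieldType) (V E : finType) (G : graph R V E)
    (v : V) (d : R) : Prop :=
  (exists2 w, is_path G (rootv G) v w & d = \sum_(s <- w) cost G s.1) /\
  (forall w, is_path G (rootv G) v w -> d <= \sum_(s <- w) cost G s.1).

(* [chi] is the maximum of the distances from the root; in particular all these
   distances exist, that is, the graph is connected. *)
Definition is_eccentricity (R : realFieldType) (V E : finType)
    (G : graph R V E) (chi : R) : Prop :=
  (exists2 v, v \in verts G & is_dist G v chi) /\
  (forall v, v \in verts G -> exists2 d, is_dist G v d & d <= chi).

(* The subgraph formed by the root and the edges of [A]. *)
Definition spanned (R : realFieldType) (V E : finType) (G : graph R V E)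
    (A : {set E}) : subgraph V E :=
  (rootv G |: \bigcup_(e in A) [set (ends G e).1; (ends G e).2], A).

Definition prize_verts (R : realFieldType) (V E : finType) (G : graph R V E)
  : {set V} := [set v in verts G | 0 < prize G v].

Definition spans_prizes (R : realFieldType) (V E : finType) (G : graph R V E)
    (pi : seq E) : bool :=
  prize_verts G \subset (spanned G [set:: pi]).1.

Definition alg (R : realFieldType) (V E : finType) (G : graph R V E)
    (pi : seq E) (B : R) : subgraph V E :=
  spanned G [set tnth (in_tuple pi) i | i : 'I_(size pi) &
    \sum_(j < size pi | (j <= i)%N) cost G (tnth (in_tuple pi) j) <= B].

Definition restrict (R : realFieldType) (V E : finType) (G : graph R V E)
    (T : subgraph V E) : graph R V E :=
  Graph T.1 T.2 (ends G) (cost G) (prize G) (rootv G).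

Definition contract (R : realFieldType) (V E : finType) (H : graph R V E)
    (T : subgraph V E) : graph R V E :=
  let f v := if v \in T.1 then rootv H else v in
  Graph (rootv H |: (verts H :\: T.1)) (edges H :\: T.2)
    (fun e => (f (ends H e).1, f (ends H e).2))
    (cost H)
    (fun v => if v == rootv H then 0 else prize H v)
    (rootv H).

Definition density (R : realFieldType) (V E : finType) (G : graph R V E)
    (S : subgraph V E) : R :=
  if S.2 == set0 then 0 else prize_of G S / cost_of G S.

Definition min_max_subtree (R : realFieldType) (V E : finType)
    (G : graph R V E) (S : subgraph V E) : Prop :=
  [/\ rooted_subtree G S,
      forall T, rooted_subtree G T -> density G T <= density G S &
      forall T, rooted_subtree G T -> density G T = density G S ->
        T.1 \subset S.1 -> T.2 \subset S.2 -> T = S].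

Definition total_prize (R : realFieldType) (V E : finType) (G : graph R V E)
  : R := \sum_(v in verts G) prize G v.

Definition incident (R : realFieldType) (V E : finType) (G : graph R V E)
    (e : E) (v : V) : bool :=
  ((ends G e).1 == v) || ((ends G e).2 == v).

Definition add_edge (R : realFieldType) (V E : finType) (G : graph R V E)
    (T : subgraph V E) (e : E) : subgraph V E :=
  ([set (ends G e).1; (ends G e).2] :|: T.1, e |: T.2).

(* [greedy_from H T pi]: the density-greedy loop, entered with current subtree
   [T], can output the further edges [pi]. *)
Inductive greedy_from (R : realFieldType) (V E : finType) (H : graph R V E)
  : subgraph V E -> seq E -> Prop :=
| GreedyStop (T : subgraph V E) :
    total_prize (contract H T) = 0 -> greedy_from H T [::]
| GreedyStep (T S : subgraph V E) (e : E) (pi : seq E) :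
    total_prize (contract H T) <> 0 ->
    min_max_subtree (contract H T) S ->
    e \in S.2 -> incident (contract H T) e (rootv H) ->
    greedy_from H (add_edge H T e) pi ->
    greedy_from H T (e :: pi).

Definition density_greedy (R : realFieldType) (V E : finType)
    (H : graph R V E) (pi : seq E) : Prop :=
  greedy_from H ([set rootv H], set0) pi.

Definition parallel (R : realFieldType) (V E : finType) (G : graph R V E)
    (e f : E) : bool := joins G e (ends G f).1 (ends G f).2.

Definition skipped (R : realFieldType) (V E : finType) (G : graph R V E)
    (pi : seq E) (e : E) : Prop :=
  [\/ e \in pi,
      exists2 f, f \in pi & parallel G e f |
      exists x w, is_cycle G (e |: [set:: pi]) x w /\ e \in unzip1 w].

(* [append_skipping G pi s pi']: appending [s] to [pi], with the prescribed
   edges skipped, yields [pi']. *)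
Inductive append_skipping (R : realFieldType) (V E : finType)
    (G : graph R V E) : seq E -> seq E -> seq E -> Prop :=
| AppendNil (pi : seq E) : append_skipping G pi [::] pi
| AppendSkip (pi s pi' : seq E) (e : E) :
    skipped G pi e -> append_skipping G pi s pi' ->
    append_skipping G pi (e :: s) pi'
| AppendKeep (pi s pi' : seq E) (e : E) :
    ~ skipped G pi e -> append_skipping G (rcons pi e) s pi' ->
    append_skipping G pi (e :: s) pi'.

(* [scaling_from G chi i pi out]: the capacity-scaling loop, entered with
   counter [i] and sequence [pi], can output [out]. *)
Inductive scaling_from (R : realFieldType) (V E : finType) (G : graph R V E)
    (chi : R) : nat -> seq E -> seq E -> Prop :=
| ScalingStop (i : nat) (pi : seq E) :
    spans_prizes G pi -> scaling_from G chi i pi pi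
| ScalingStep (i : nat) (pi s pi' out : seq E) (T : subgraph V E) :
    ~~ spans_prizes G pi ->
    is_opt G (2 ^+ i * chi) T ->
    density_greedy (restrict G T) s ->
    append_skipping G pi s pi' ->
    scaling_from G chi i.+1 pi' out ->
    scaling_from G chi i pi out.

Definition capacity_scaling (R : realFieldType) (V E : finType)
    (G : graph R V E) (chi : R) (out : seq E) : Prop :=
  scaling_from G chi 0 [::] out.

(* Main.v *)
Require Import Defs.
From mathcomp Require Import all_boot all_order all_algebra.
From mathcomp Require Import ring lra zify.

(** Let [N = B + 4 l chi].  The first [j] phases cost at most
    [(2^j - 1) chi], so with budget [N - chi] and [2^j chi <= N < 2^(j+1) chi]
    the algorithm has collected all prizes of the optimal tree for budget
    [2^(j-1) chi >= B / 4 + l chi]; if there is no such [j], it has collected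
    everything.  It remains to see that a tree [T] always has [l] connected
    pieces of total cost at most [c(T) / 4] and total prize at least
    [(1 - 2^-l) p(T) / 4]: each of them is then connected to the root at cost
    at most [chi].

    The pieces are chosen one after the other.  A tree of density 1 and cost at
    least [b] has a connected piece of cost [s <= b] and prize at least
    [max(s, b / 2)]; so each piece is as dense as the tree and contributes at
    least half of what the remaining budget is worth at that density.  Setting
    the costs and prizes of a chosen piece to zero plays the role of contracting
    it, and every further piece halves the missing fraction.  The density order
    inside a phase is irrelevant to this argument. *)

Set Implicit Arguments.
Unset Strict Implicit.
Unset Printing Implicit Defensive.

Import Order.TTheory GRing.Theory Num.Theory.
Local Open Scope ring_scope.

(* The branches hanging from a vertex that is not itself recorded: a rooted
   tree is a pair of a root and a forest. *)
Inductive forest (V E : Type) : Type :=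
| Bare
| Branch (e : E) (v : V) (children siblings : forest V E).
Arguments Bare {V E}.

(** * Rooted forests and dense connected pieces of a weighted tree *)

Section Forest.
Variables (R : realFieldType) (V E : finType) (G : graph R V E).
Implicit Types F : forest V E.

Fixpoint fapp F1 F2 : forest V E :=
  if F1 is Branch e v K L then Branch e v K (fapp L F2) else F2.

Fixpoint fverts F : seq V :=
  if F is Branch _ v K L then v :: fverts K ++ fverts L else [::].

Fixpoint fedges F : seq E :=
  if F is Branch e _ K L then e :: fedges K ++ fedges L else [::].

Fixpoint hangs (z : V) F : bool :=
  if F is Branch e v K L then [&& joins G e z v, hangs v K & hangs z L]
  else true.

Lemma joinsC e x y : joins G e x y = joins G e y x.
Proof. by rewrite /joins orbC. Qed.

Lemma hangs_fapp z F1 F2 :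
  hangs z (fapp F1 F2) = hangs z F1 && hangs z F2.
Proof. by elim: F1 => //= e v K _ L ->; rewrite !andbA. Qed.

Lemma fverts_fapp F1 F2 :
  fverts (fapp F1 F2) = fverts F1 ++ fverts F2.
Proof. by elim: F1 => //= e v K _ L ->; rewrite catA. Qed.

Lemma fedges_fapp F1 F2 :
  fedges (fapp F1 F2) = fedges F1 ++ fedges F2.
Proof. by elim: F1 => //= e v K _ L ->; rewrite catA. Qed.

(* Each count and size is abstracted to keep the booleans [v == x] away from
   [lia]. *)
Ltac count_lia :=
  rewrite /= ?(fverts_fapp, fedges_fapp, count_cat, size_cat) /=
    ?(count_cat, size_cat) /= ?(count_cat, size_cat);
  repeat match goal with
  | |- context [nat_of_bool ?b] => generalize (nat_of_bool b); intro
  | |- context [count ?a ?s] => generalize (count a s); intro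
  | |- context [size ?s] => generalize (size s); intro
  end; clear; lia.

(** Inclusion is measured by multiplicities: this is insensitive to rearranging and re-rooting the
    tree, is decided by linear arithmetic, and lets a piece inherit freedom from repetitions. *)
Definition subpiece (z' : V) (F' : forest V E) (vs : seq V) (es : seq E) :=
  [/\ hangs z' F',
      forall x, (count_mem x (z' :: fverts F') <= count_mem x vs)%N &
      forall x, (count_mem x (fedges F') <= count_mem x es)%N].

Section DensePiece.
Variables (p : V -> R) (c : E -> R).
Hypotheses (p_ge0 : forall v, 0 <= p v) (c_ge0 : forall e, 0 <= c e).

Let prz F := \sum_(v <- fverts F) p v.
Let cst F := \sum_(e <- fedges F) c e.

Let przE e v K L : prz (Branch e v K L) = p v + prz K + prz L.
Proof. by rewrite /prz /= big_cons big_cat addrA. Qed.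

Let cstE e v K L : cst (Branch e v K L) = c e + cst K + cst L.
Proof. by rewrite /cst /= big_cons big_cat addrA. Qed.

Let prz_fapp F1 F2 : prz (fapp F1 F2) = prz F1 + prz F2.
Proof. by rewrite /prz fverts_fapp big_cat. Qed.

Let cst_fapp F1 F2 : cst (fapp F1 F2) = cst F1 + cst F2.
Proof. by rewrite /cst fedges_fapp big_cat. Qed.

Let prz0 : prz Bare = 0. Proof. exact: big_nil. Qed.
Let cst0 : cst Bare = 0. Proof. exact: big_nil. Qed.
Let cst_ge0 F : 0 <= cst F. Proof. exact: sumr_ge0. Qed.
Let prz_ge0 F : 0 <= prz F. Proof. exact: sumr_ge0. Qed.

Let size_gt0 F : 0 < cst F -> (0 < size (fedges F))%N.
Proof. by case: F => //; rewrite cst0 ltxx. Qed.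

(* Here [h] is half of the budget.  The proof descends into [A] until both the
   children and the siblings of its first branch cost less than [h]; there the
   tree is split at that branch's edge, or at [z] in two or three parts, and
   averaging finds a dense part. *)
Lemma dense_proper_piece (h : R) (A : forest V E) : 0 < h -> forall z B,
  hangs z A -> hangs z B -> h <= cst A -> 2 * h < cst A + cst B ->
  cst A + cst B <= p z + prz A + prz B ->
  exists z' F', [/\ subpiece z' F' (z :: fverts A ++ fverts B)
                                   (fedges A ++ fedges B),
    (size (fedges F') < size (fedges A) + size (fedges B))%N,
    cst F' <= p z' + prz F' & h <= p z' + prz F'].
Proof.
move=> h0; elim: A => [|e v F1 IH1 F2 IH2] z B.
  by rewrite cst0 => _ _; lra.
move=> /= /and3P[jzv hF1 hF2] hB; rewrite cstE przE => hA hAB hp.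
have c0 := c_ge0 e; have pz0 := p_ge0 z; have pv0 := p_ge0 v.
have [hF2h|F2h] := leP h (cst F2).
  (* The heavy siblings take the role of [A]; the first branch moves to the other side. *)
  have hB' : hangs z (Branch e v F1 B) by rewrite /= jzv hF1.
  case: (IH2 z (Branch e v F1 B)) => //.
  - by rewrite cstE; lra.
  - by rewrite cstE przE; lra.
  move=> z' [F' [[hF' cv ce] sF' ? ?]]; exists z', F'; split=> //.
    by split=> // x; [move: (cv x) | move: (ce x)]; count_lia.
  by move: sF'; count_lia.
have [hF1h|F1h] := leP h (cst F1).
  (* Re-rooting at [v]: the edge [e] is reversed, and the old root [z] becomes a child of [v]
     carrying everything outside [F1]. *)
  have hB' : hangs v (Branch e z (fapp F2 B) Bare).
    by rewrite /= joinsC jzv hangs_fapp hF2 hB.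
  case: (IH1 v (Branch e z (fapp F2 B) Bare)) => //.
  - by rewrite cstE cst0 cst_fapp; lra.
  - by rewrite cstE przE cst0 prz0 cst_fapp prz_fapp; lra.
  move=> z' [F' [[hF' cv ce] sF' ? ?]]; exists z', F'; split=> //.
    by split=> // x; [move: (cv x) | move: (ce x)]; count_lia.
  by move: sF'; count_lia.
pose good z' F' := (cst F' <= p z' + prz F') && (h <= p z' + prz F').
suff: [\/ good v F1, good z (fapp F2 B),
         (good z (Branch e v F1 F2) \/ good z B) /\ (0 < size (fedges B))%N |
         good z (Branch e v F1 B) /\ (0 < size (fedges F2))%N].
  have sub z' F' : hangs z' F' ->
    (forall x, (count_mem x (z' :: fverts F')
       <= count_mem x (z :: fverts (Branch e v F1 F2) ++ fverts B))%N) ->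
    (forall x, (count_mem x (fedges F')
       <= count_mem x (fedges (Branch e v F1 F2) ++ fedges B))%N) ->
    (size (fedges F') < size (fedges (Branch e v F1 F2)) + size (fedges B))%N ->
    good z' F' -> exists z' F',
    [/\ subpiece z' F' (z :: fverts (Branch e v F1 F2) ++ fverts B)
                       (fedges (Branch e v F1 F2) ++ fedges B),
    (size (fedges F') < size (fedges (Branch e v F1 F2)) + size (fedges B))%N,
    cst F' <= p z' + prz F' & h <= p z' + prz F'].
    by move=> hF' cv ce sF' /andP[? ?]; exists z', F'; split.
  case=> [g|g|[[g|g] sB]|[g sF2]]; apply: sub g => //=;
    rewrite ?jzv ?hangs_fapp ?hF1 ?hF2 ?hB //; try (move=> x);
    first [ solve [count_lia] | solve [move: sB; count_lia]
          | move: sF2; count_lia ].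
have cB := cst_ge0 B; have cF2 := cst_ge0 F2; have cF1 := cst_ge0 F1.
rewrite /good !cstE !przE !cst_fapp !prz_fapp.
(* If [e] and [F1] together cost at least [h], deleting [e] suffices. Either the side of [v] has
   prize at least [h], which exceeds its cost, or its prize is below [h], and then the side of [z]
   keeps more prize than cost and more than [h]. *)
have [he|he] := leP h (c e + cst F1).
  have [g|g] := leP h (p v + prz F1).
    by apply: Or41; apply/andP; split; lra.
  by apply: Or42; apply/andP; split; lra.
(* When [B] costs at least [h], the tree is split at [z] into two parts of cost at least [h]; as
   [p z] counts for both, one of them is dense. *)
have [hcB|cBh] := leP h (cst B).
  apply: Or43; split; last by apply: size_gt0; lra.
  have [g|g] := leP (cst B) (p z + prz B).
    by right; apply/andP; split; lra.
  by left; apply/andP; split; lra.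
have sB : (0 < size (fedges B))%N by apply: size_gt0; lra.
have sF2 : (0 < size (fedges F2))%N by apply: size_gt0; lra.
(* Three groups of cost below [h] remain: [e] with [F1], [F2], and [B]. The total exceeds [2 * h],
   so any two of them cost more than [h]. The three pairs together have twice the total cost and at
   least twice the total prize, so some pair is dense; the omitted group contains an edge. *)
have [g|g] := leP (cst F2 + cst B) (p z + (prz F2 + prz B)).
  by apply: Or42; apply/andP; split; lra.
have [g'|g'] := leP (c e + cst F1 + cst F2) (p z + (p v + prz F1 + prz F2)).
  by apply: Or43; split=> //; left; apply/andP; split; lra.
by apply: Or44; split=> //; apply/andP; split; lra.
Qed.

(** Passing to proper dense pieces is repeated until the cost fits into [2 * h]; the number of edges
    strictly decreases. For [h = 0] the root alone is such a piece. *)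
Lemma dense_piece (h : R) (z : V) F :
  0 <= h -> hangs z F -> cst F <= p z + prz F -> h <= p z + prz F ->
  exists z' F', [/\ subpiece z' F' (z :: fverts F) (fedges F),
    cst F' <= 2 * h, cst F' <= p z' + prz F' & h <= p z' + prz F'].
Proof.
rewrite le_eqVlt => /predU1P[<-|h0] hF cF hpF.
  exists z, Bare; rewrite mulr0 cst0 prz0 addr0; split=> //.
  by split=> // x /=; lia.
have [n] := ubnP (size (fedges F)).
elim: n z F hF cF hpF => // n IH z F hF cF hpF sF.
have [cFh|cFh] := leP (cst F) (2 * h); first by exists z, F; split.
have [|||z1 [F1 [[hF1 cv ce] sF1 c1 h1]]] :=
  @dense_proper_piece h F h0 z Bare hF isT; rewrite ?cst0 ?prz0; try lra.
have [|z' [F' [[hF' cv' ce'] ? ? ?]]] := IH z1 F1 hF1 c1 h1.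
  by move: sF1 sF; rewrite /=; lia.
exists z', F'; split=> //; split=> // x.
  by apply: leq_trans (cv' x) _; have := cv x; rewrite cats0.
by apply: leq_trans (ce' x) _; have := ce x; rewrite cats0.
Qed.

End DensePiece.
End Forest.

(** * Sums over sets, multiplicities, and the arithmetic of one greedy choice *)

(** The masked summand is the weight that remains after [X] has been chosen and its weights set to
    zero. [U] and [X] may overlap without double counting. *)
Lemma sum_setU_masked (R : nmodType) (T : finType) (f : T -> R)
    (U X : {set T}) :
  \sum_(x in U :|: X) f x
    = \sum_(x in X) f x + \sum_(x in U) (if x \in X then 0 else f x).
Proof.
rewrite (big_setID X) /=; congr (_ + _).
  by apply: eq_bigl => x; rewrite !inE; case: (x \in X); rewrite ?orbT ?andbF.
rewrite [RHS](bigID (mem X)) /= [X in _ = X + _]big1; last first.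
  by move=> x /andP[_ ->].
rewrite add0r; apply: eq_big => x; last by rewrite !inE => /andP[/negPf->].
by rewrite !inE andbC; case: (x \in X); rewrite ?andbF ?orbF.
Qed.

Lemma sum_uniq_set (R : nmodType) (T : finType) (f : T -> R) (s : seq T) :
  uniq s -> \sum_(x <- s) f x = \sum_(x in [set:: s]) f x.
Proof.
by move=> us; rewrite big_uniq //=; apply: eq_bigl => x; rewrite inE.
Qed.

Lemma uniq_sub_count (T : eqType) (s1 s2 : seq T) :
  uniq s2 -> (forall x, (count_mem x s1 <= count_mem x s2)%N) -> uniq s1.
Proof.
move=> us le12; apply: count_mem_uniq => x; have := le12 x.
rewrite (count_uniq_mem _ us) -(has_pred1 x s1) has_count.
by case: (count_mem x s1) => [|[|n]]; case: (x \in s2).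
Qed.

Lemma subset_count (T : finType) (s1 s2 : seq T) :
  (forall x, (count_mem x s1 <= count_mem x s2)%N) ->
  [set:: s1] \subset [set:: s2].
Proof.
move=> le12; apply/subsetP => x.
rewrite [x \in _]inE [x \in [set:: s2]]inE -!has_pred1 !has_count.
by move=> h; apply: leq_trans h (le12 x).
Qed.

(** One choice improves the guaranteed fraction from [la] to [(1 + la) / 2]. Here [C] and [P] are
    the total cost and prize, [b] the budget, [s] and [q] the cost and prize of the first piece, and
    [q'] the prize gained from the rest with budget [b - s]. *)
Lemma greedy_budget_arith (R : realFieldType) (C b s P q q' la : R) :
  0 <= s -> s <= b -> b <= C -> 0 <= la -> la <= 1 -> 0 <= P -> q <= P ->
  0 <= q' -> P * s <= C * q -> P * b / 2 <= C * q ->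
  (b - s) * la * (P - q) <= (C - s) * q' ->
  b * ((1 + la) / 2) * P <= C * (q + q').
Proof.
move=> s0 sb bC la0 la1 P0 qP q'0 Ps Pb hq'.
(* If the piece uses up the total cost, then [s = b = C] and the piece alone suffices; otherwise one
   may multiply by [C - s]. *)
have [Cs|Cs] := leP C s.
  have -> : b = C by lra.
  have sC : s = C by lra.
  rewrite sC in Ps.
  have C0 : 0 <= C by lra.
  have := mulr_ge0 C0 q'0.
  have : 0 <= (C * P) * (1 - la) by rewrite !mulr_ge0 ?subr_ge0.
  lra.
have C0 : 0 < C - s by lra.
rewrite -(ler_pM2l C0).
(* After multiplication by [C - s] and insertion of the bound on [q'], [k] is the coefficient of
   [C * q]. As [k] is nonnegative, [C * q] can be replaced by its better lower bound: [P * s] if [s]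
   is at least [b / 2], and [P * b / 2] otherwise. *)
pose k := (C - s) - (b - s) * la.
have k0 : 0 <= k.
  have : (b - s) * la <= (b - s) * 1 by rewrite ler_wpM2l // subr_ge0.
  by rewrite /k; lra.
have hC : C * ((b - s) * la * (P - q)) <= C * ((C - s) * q').
  by rewrite ler_wpM2l //; lra.
suff : (C - s) * (b * ((1 + la) / 2) * P) <= C * q * k + C * ((b - s) * la) * P.
  by rewrite /k; lra.
have [hs|hs] := leP b (2 * s).
  have h1 : P * s * k <= C * q * k by rewrite ler_wpM2r.
  have h2 : 0 <= ((C - s) * P) * ((1 - la) * (s - b / 2)).
    by rewrite !mulr_ge0 //; lra.
  by move: h1 h2; rewrite /k; lra.
have h1 : P * b / 2 * k <= C * q * k by rewrite ler_wpM2r.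
have h2 : 0 <= (la * P) * ((C - b) * (b / 2 - s)).
  by rewrite !mulr_ge0 //; lra.
by move: h1 h2; rewrite /k; lra.
Qed.

(** * Connectivity by edge sets, and the iterated choice of dense pieces *)

Section Connectivity.
Variables (R : realFieldType) (V E : finType) (G : graph R V E).
Implicit Types (A : {set E}) (F : forest V E).

Definition adj A : rel V := [rel x y | [exists e in A, joins G e x y]].

Lemma adjP A x y : reflect (exists2 e, e \in A & joins G e x y) (adj A x y).
Proof. exact: (iffP exists_inP). Qed.

Lemma adj_connect_sym A : connect_sym (adj A).
Proof.
apply: sym_connect_sym => x y.
by apply/adjP/adjP => -[e eA je]; exists e; rewrite // joinsC.
Qed.

Lemma connect_adjS A A' x y :
  A \subset A' -> connect (adj A) x y -> connect (adj A') x y.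
Proof.
move=> /subsetP sA; apply: connect_sub => u v /adjP[e eA je].
by apply/connect1/adjP; exists e; rewrite ?sA.
Qed.

Lemma connect_edge A e x y : e \in A -> joins G e x y -> connect (adj A) x y.
Proof. by move=> eA je; apply/connect1/adjP; exists e. Qed.

Lemma walk_connect A x w : walk G A x w -> connect (adj A) x (walk_end x w).
Proof.
elim: w x => [|[e y] w IH] x /=; first by rewrite connect0.
move=> /and3P[eA je /IH]; apply: connect_trans; exact: connect_edge je.
Qed.

Lemma connect_walk A x y :
  connect (adj A) x y -> exists2 w, walk G A x w & walk_end x w = y.
Proof.
move=> /connectP[q]; elim: q x => [|u q IH] x /= => [_ ->|].
  by exists [::].
move=> /andP[/adjP[e eA je]] /IH{}IH /IH[w hw wy].
by exists ((e, u) :: w); rewrite //= eA je.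
Qed.

Lemma hangs_connect z F v :
  hangs G z F -> v \in z :: fverts F -> connect (adj [set:: fedges F]) z v.
Proof.
elim: F z => [|e u K IHK L IHL] z /=; first by rewrite inE => _ /eqP->.
move=> /and3P[je hK hL].
have sK : [set:: fedges K] \subset [set:: e :: fedges K ++ fedges L].
  by apply/subsetP => f; rewrite !inE mem_cat => ->; rewrite orbT.
have sL : [set:: fedges L] \subset [set:: e :: fedges K ++ fedges L].
  by apply/subsetP => f; rewrite !inE mem_cat => ->; rewrite !orbT.
rewrite inE => /predU1P[->|]; first exact: connect0.
rewrite -cat_cons mem_cat => /orP[vK|vL].
  apply: (@connect_trans _ _ u); last exact: connect_adjS sK (IHK _ hK vK).
  by apply: connect_edge je; rewrite !inE eqxx.
by apply: connect_adjS sL (IHL _ hL _); rewrite inE vL orbT.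
Qed.

(** Induction on the number of pieces, for all weights at once: later pieces are sought in the same
    tree with the weights of the first piece set to zero. [Z] records one vertex of each piece, at
    which it will be attached to the root. *)
Lemma dense_pieces (z : V) F :
  hangs G z F -> uniq (z :: fverts F) -> uniq (fedges F) ->
  forall (l : nat) (p : V -> R) (c : E -> R) (b : R),
  (forall v, 0 <= p v) -> (forall e, 0 <= c e) -> 0 <= b ->
  b <= \sum_(e in [set:: fedges F]) c e ->
  exists Z (U : {set V}) (W : {set E}),
  [/\ (size Z <= l)%N,
      {subset Z <= z :: fverts F} /\
      U \subset [set:: z :: fverts F] /\ W \subset [set:: fedges F],
      forall u, u \in U -> exists2 y, y \in Z & connect (adj W) y u,
      \sum_(e in W) c e <= b &
      b * (1 - (2 ^+ l)^-1) * \sum_(v in [set:: z :: fverts F]) p v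
        <= (\sum_(e in [set:: fedges F]) c e) * \sum_(v in U) p v].
Proof.
move=> hF uV uE; set X := [set:: z :: fverts F]; set A := [set:: fedges F].
elim=> [|l IH] p c b p0 c0 b0 bC.
  exists [::], set0, set0; rewrite !sub0set !big_set0; split=> //.
    by move=> u; rewrite inE.
  by rewrite expr0 invr1 subrr !(mulr0, mul0r).
set C := \sum_(e in A) c e in bC *; set P := \sum_(v in X) p v.
have P0 : 0 <= P by apply: sumr_ge0.
(* For [P = 0] the costs scaled by [P] below would no longer bound the true cost of a piece. *)
have [Pe|Pn] := eqVneq P 0.
  exists [::], set0, set0; rewrite !sub0set !big_set0; split=> //.
    by move=> u; rewrite inE.
  by rewrite Pe !mulr0.
have Pp : 0 < P by rewrite lt_def Pn.
have C0 : 0 <= C by apply: sumr_ge0.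
have sumV (f : V -> R) : f z + \sum_(v <- fverts F) f v = \sum_(v in X) f v.
  by rewrite -sum_uniq_set // big_cons.
have sumE (f : E -> R) : \sum_(v <- fedges F) f v = \sum_(v in A) f v.
  by rewrite -sum_uniq_set.
(* Multiplying prizes by [C] and costs by [P] gives the tree density 1 without division. The half
   budget [P * b / 2] then limits the true cost of the piece to [b]. *)
have [||||||z1 [F1 [[hF1 cv ce] s1 s2 s3]]] :=
  @dense_piece _ _ _ G (fun v => C * p v) (fun e => P * c e) _ _
    (P * b / 2) z F.
- by move=> v; rewrite mulr_ge0.
- by move=> e; rewrite mulr_ge0.
- by rewrite divr_ge0 ?mulr_ge0.
- by [].
- by rewrite sumV sumE -!mulr_sumr -/C -/P mulrC.
- rewrite sumV -!mulr_sumr -/P (mulrC C).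
  by have := ler_wpM2l P0 bC; have := mulr_ge0 P0 C0; lra.
have uV1 : uniq (z1 :: fverts F1).
  by exact: uniq_sub_count uV cv.
have uE1 : uniq (fedges F1).
  by exact: uniq_sub_count uE ce.
set X1 := [set:: z1 :: fverts F1]; set A1 := [set:: fedges F1].
have sX : X1 \subset X by apply: subset_count.
have sA : A1 \subset A by apply: subset_count.
move: s1 s2 s3; rewrite -!mulr_sumr -!mulrDr.
rewrite (sum_uniq_set _ uE1) -/A1.
have -> : p z1 + \sum_(v <- fverts F1) p v = \sum_(v in X1) p v.
  by rewrite -sum_uniq_set // big_cons.
set s := \sum_(e in A1) c e; set q := \sum_(v in X1) p v => s1 s2 s3.
have s0 : 0 <= s by apply: sumr_ge0.
have sb : s <= b by rewrite -(ler_pM2l Pp); lra.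
pose p2 v := if v \in X1 then 0 else p v.
pose c2 e := if e \in A1 then 0 else c e.
have P2 : P = q + \sum_(v in X) p2 v.
  by rewrite -sum_setU_masked (setUidPl sX).
have C2 : C = s + \sum_(e in A) c2 e.
  by rewrite -sum_setU_masked (setUidPl sA).
have [||||Z [U [W [sZ [ZF [UX WA]] conn cW pU]]]] := IH p2 c2 (b - s).
- by move=> v; rewrite /p2; case: ifP.
- by move=> v; rewrite /c2; case: ifP.
- by rewrite subr_ge0.
- by lra.
exists (z1 :: Z), (U :|: X1), (W :|: A1); split.
- by [].
- split; last by rewrite !subUset UX WA.
  move=> y; rewrite inE => /predU1P[->|/ZF//].
  by have := subsetP sX z1; rewrite !inE eqxx; apply.
- move=> u; rewrite inE => /orP[/conn[y yZ hy]|].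
    exists y; first by rewrite inE yZ orbT.
    by apply: connect_adjS hy; apply: subsetUl.
  rewrite inE => uX; exists z1; first by rewrite inE eqxx.
  by apply: connect_adjS (hangs_connect hF1 uX); apply: subsetUr.
(* [W] may run through edges of [A1] at masked cost 0; their true cost is paid once, in [s]. *)
- by rewrite sum_setU_masked -/s; move: cW; rewrite -/c2; lra.
rewrite sum_setU_masked -/q.
have -> : 1 - (2 ^+ l.+1)^-1 = (1 + (1 - (2 ^+ l)^-1)) / 2 :> R.
  by rewrite exprS invfM; lra.
have e0 : 0 < 2 ^+ l :> R by rewrite exprn_gt0.
have e1 : (2 ^+ l)^-1 <= 1 :> R by rewrite invf_le1 // exprn_ege1 // ler1n.
have e2 : 0 < (2 ^+ l)^-1 :> R by rewrite invr_gt0.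
apply: (@greedy_budget_arith _ C b s P q); rewrite ?subr_ge0 //.
- by lra.
- by rewrite P2 lerDl; apply: sumr_ge0 => v _; rewrite /p2; case: ifP.
- by apply: sumr_ge0 => v _; case: ifP.
- have -> : P - q = \sum_(v in X) p2 v by rewrite P2; ring.
  by have -> : C - s = \sum_(e in A) c2 e by rewrite C2; ring.
Qed.

End Connectivity.

(** * Spanning trees, trees as forests, and paths from the root *)

Section SpanningTree.
Variables (R : realFieldType) (V E : finType) (G : graph R V E).
Implicit Types (A : {set E}) (F : forest V E).

Lemma connect_crossing (r : rel V) (K : {pred V}) x y :
  connect r x y -> x \in K -> y \notin K ->
  exists u w, [/\ u \in K, w \notin K & r u w].
Proof.
move=> /connectP[q]; elim: q x => [|u q IH] x /= => [_ -> ->//|].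
move=> /andP[rxu hq] ey xK yK; have [uK|uK] := boolP (u \in K).
  exact: IH hq ey uK yK.
by exists x, u.
Qed.

Lemma connect_closed (r : rel V) (K : {pred V}) x y :
  x \in K -> (forall u w, u \in K -> r u w -> w \in K) ->
  connect r x y -> y \in K.
Proof.
move=> xK cl cxy; apply: contraT => yK.
have [u [w [uK wK /(cl u w uK)]]] := connect_crossing cxy xK yK.
by rewrite (negPf wK).
Qed.

Lemma joins_ends e : joins G e (ends G e).1 (ends G e).2.
Proof. by rewrite /joins -surjective_pairing eqxx. Qed.

Lemma joins_endsE e x y : joins G e x y ->
  [set x; y] = [set (ends G e).1; (ends G e).2].
Proof. by case/orP => /eqP-> //=; rewrite setUC. Qed.

Lemma walk_sub A A' x w :
  walk G A x w -> {subset unzip1 w <= A'} -> walk G A' x w.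
Proof.
elim: w x => //= -[f y] w IH x /= /and3P[fA -> hw] sA'.
rewrite sA' ?mem_head //=; apply: IH hw _ => g gw.
by rewrite sA' // inE gw orbT.
Qed.

Lemma walk_edges A x w : walk G A x w -> {subset unzip1 w <= A}.
Proof.
elim: w x => // -[e y] w IH x /= /and3P[eA _ hw] f.
by rewrite inE => /predU1P[->//|]; apply: IH hw f.
Qed.

(** An inclusion-minimal edge set that preserves reachability from the root is acyclic, since an
    edge on a cycle could be dropped. *)
Lemma spanning_rooted_subtree (A : {set E}) :
  instance G -> A \subset edges G ->
  exists S, [/\ rooted_subtree G S,
    S.1 = [set v | connect (adj G A) (rootv G) v] & S.2 \subset A].
Proof.
move=> hG AE; set r := rootv G.
pose spanning (B : {set E}) :=
  [forall v, connect (adj G A) r v ==> connect (adj G B) r v].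
(* Starting from edges with a reached end puts both ends of every remaining edge into the vertex set
   of the subtree. *)
pose B := [set e in A | connect (adj G A) r (ends G e).1].
have BA : B \subset A by apply/subsetP => e; rewrite inE => /andP[].
have spB : spanning B.
  apply/forallP => v; apply/implyP; pose K := [pred v | connect (adj G B) r v].
  apply: (@connect_closed _ K); first by rewrite inE connect0.
  move=> u w; rewrite !inE => ru /adjP[e eA je].
  have rAu : connect (adj G A) r u by apply: connect_adjS ru.
  apply: connect_trans ru _; apply: connect_edge (je); rewrite inE eA /=.
  have rAw := connect_trans rAu (connect_edge eA je).
  by case/orP: je => /eqP->.
have [A' /minsetP[/forallP spA' minA'] A'B] := minset_exists spB.
have rA' v : connect (adj G A) r v -> connect (adj G A') r v.
  by have /implyP := spA' v; apply.
exists ([set v | connect (adj G A) r v], A'); split=> //; last first.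
  exact: subset_trans BA.
have hroot := root_in hG; split=> /=.
- split=> /=.
  + apply/subsetP => v; rewrite inE; apply: connect_closed hroot _.
    move=> u w uG /adjP[e /(subsetP AE)/(ends_in hG)[e1 e2]].
    by case/orP => /eqP ee; move: e1 e2; rewrite ee.
  + exact: subset_trans (subset_trans A'B BA) AE.
  + move=> e /(subsetP A'B); rewrite !inE => /andP[eA re]; split=> //.
    by apply: connect_trans re _; apply: connect_edge (joins_ends e).
- by rewrite inE connect0.
- move=> x y; rewrite !inE => /rA' rx /rA' ry; apply: connect_walk.
  by apply: connect_trans ry; rewrite adj_connect_sym.
(* The remainder [w] of the cycle leads from [y] back to [x] without [e], so it replaces [e] in
   every connection. *)
move=> x [|[e y] w] [//= _ /and3P[eA' je hw] yx /andP[ew _] _].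
pose A'' := A' :\ e.
have yxA : connect (adj G A'') y x.
  rewrite -[X in connect _ _ X]yx; apply: walk_connect; apply: walk_sub (hw) _.
  move=> f fw; rewrite in_setD1 (walk_edges hw fw) andbT.
  by apply: contraNneq ew => <-.
have A''_sp : spanning A''.
  apply/forallP => v; apply/implyP => /rA'; apply: connect_sub => u u' /adjP[f].
  have [->|fe] := eqVneq f e => fA' jf; last first.
    by apply: connect_edge jf; rewrite !inE fe fA'.
  have : [set u; u'] = [set x; y] by rewrite (joins_endsE jf) (joins_endsE je).
  have xyA : connect (adj G A'') x y by rewrite adj_connect_sym.
  move: jf je; rewrite /joins => /orP[]/eqP-> /orP[]/eqP[-> ->] //.
have := minA' A'' A''_sp (subD1set A' e).
by move/setP/(_ e); rewrite !inE eqxx eA'.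
Qed.

Lemma hangs_add_leaf z F y e x :
  hangs G z F -> y \in z :: fverts F -> joins G e y x ->
  exists F', [/\ hangs G z F', perm_eq (fverts F') (x :: fverts F) &
    perm_eq (fedges F') (e :: fedges F)].
Proof.
move=> + + je; elim: F z => [|f u K IHK L IHL] z /=.
  by rewrite inE => _ /eqP ez; exists (Branch e x Bare Bare); rewrite /= -ez je.
move=> /and3P[jf hK hL]; rewrite inE => /predU1P[ez|].
  by exists (Branch e x Bare (Branch f u K L)); rewrite /= -ez je ez jf hK hL.
rewrite -cat_cons mem_cat => /orP[/(IHK _ hK)[K' [hK' pv pe]]|yL].
  exists (Branch f u K' L); rewrite /= jf hK' hL; split=> //.
    apply: (perm_trans _ (permEl (perm_catCA [:: u] [:: x] _))).
    by rewrite -(perm_cat2r (fverts L)) -(perm_cons u) in pv.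
  apply: (perm_trans _ (permEl (perm_catCA [:: f] [:: e] _))).
  by rewrite -(perm_cat2r (fedges L)) -(perm_cons f) in pe.
have [|L' [hL' pv pe]] := IHL _ hL; first by rewrite inE yL orbT.
exists (Branch f u K L'); rewrite /= jf hK hL'; split=> //.
  apply: (perm_trans _ (permEl (perm_catCA (u :: fverts K) [:: x] _))).
  by rewrite -(perm_cat2l (fverts K)) -(perm_cons u) in pv.
apply: (perm_trans _ (permEl (perm_catCA (f :: fedges K) [:: e] _))).
by rewrite -(perm_cat2l (fedges K)) -(perm_cons f) in pe.
Qed.

Lemma hangs_ends z F e x y :
  hangs G z F -> e \in fedges F -> joins G e x y -> x \in z :: fverts F.
Proof.
elim: F z => //= f u K IHK L IHL z /and3P[jf hK hL].
rewrite inE => /predU1P[->|] .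
  move/joins_endsE; rewrite -(joins_endsE jf) => /setP/(_ x).
  rewrite !inE eqxx /=.
  by move/esym/orP => [->|->]; rewrite ?orbT.
rewrite mem_cat => /orP[eK|eL] je.
  have := IHK _ hK eK je; rewrite !inE mem_cat => /predU1P[->|->].
    by rewrite eqxx orbT.
  by rewrite !orbT.
have := IHL _ hL eL je; rewrite !inE mem_cat => /predU1P[->|->].
  by rewrite eqxx.
by rewrite !orbT.
Qed.

(** The forest grows by one leaf at a time, along an edge of [S] that leaves the vertices reached so
    far; [n] counts the vertices other than the root. *)
Lemma connected_forest (S : subgraph V E) :
  is_subgraph G S -> rootv G \in S.1 -> connected G S ->
  exists F, [/\ hangs G (rootv G) F, uniq (rootv G :: fverts F),
    [set:: rootv G :: fverts F] = S.1, uniq (fedges F) &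
    [set:: fedges F] \subset S.2].
Proof.
move=> [_ _ Sends] rS cS; set r := rootv G.
suff H n : (n < #|S.1|)%N ->
    exists2 F, size (fverts F) = n &
    [/\ hangs G r F, uniq (r :: fverts F), [set:: r :: fverts F] \subset S.1,
        uniq (fedges F) & [set:: fedges F] \subset S.2].
  have S0 : (0 < #|S.1|)%N by apply/card_gt0P; exists r.
  have [|F sF [hF uV VS uE ES]] := H #|S.1|.-1; first by lia.
  exists F; split=> //; apply/eqP; rewrite eqEcard VS /=.
  have -> : #|[set:: r :: fverts F]| = #|r :: fverts F|.
    by apply: eq_card => x; rewrite inE.
  by rewrite (card_uniqP uV) /= sF; lia.
elim: n => [|n IH] nS.
  exists Bare; rewrite //=; split=> //; last by apply/subsetP => e; rewrite inE.
  by apply/subsetP => v; rewrite !inE => /eqP->.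
have [F sF [hF uV VS uE ES]] := IH (ltnW nS).
have [x xS xF] : exists2 x, x \in S.1 & x \notin r :: fverts F.
  apply/subsetPn; apply: contraL nS => /subset_leq_card.
  by rewrite (card_uniqP uV) /= sF -leqNgt.
have [w hw wx] := cS _ _ rS xS.
have cx : connect (adj G S.2) r x by rewrite -wx; apply: walk_connect.
have [u [v [uF vF /adjP[e eS je]]]] :=
  connect_crossing cx (mem_head r (fverts F)) xF.
have [F' [hF' pV pE]] := hangs_add_leaf hF uF je.
exists F'; first by rewrite (perm_size pV) /= sF.
have pV' : perm_eq (r :: fverts F') (v :: r :: fverts F).
  apply: (perm_trans _ (permEl (perm_catCA [:: r] [:: v] _))).
  by rewrite perm_cons.
split=> //.
- by rewrite (perm_uniq pV') /= vF.
- apply/subsetP => y; rewrite inE (perm_mem pV') inE => /predU1P[->|yF].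
    by have [] := Sends e eS; case/orP: je => /eqP->.
  by apply: (subsetP VS); rewrite inE.
(* The new edge is not yet in the forest, because both ends of a forest edge are already reached. *)
- rewrite (perm_uniq pE) /= uE andbT; apply: contra vF => eF.
  by apply: hangs_ends hF eF _; rewrite joinsC; apply: je.
- apply/subsetP => f; rewrite inE (perm_mem pE) inE => /predU1P[->//|fF].
  by apply: (subsetP ES); rewrite inE.
Qed.

Lemma sum_set_seq_le (T : finType) (f : T -> R) (s : seq T) :
  (forall x, x \in s -> 0 <= f x) ->
  \sum_(x in [set:: s]) f x <= \sum_(x <- s) f x.
Proof.
elim: s => [|x s IH] f0.
  by rewrite big_nil big1 // => y; rewrite inE.
have f0s y : y \in s -> 0 <= f y by move=> ys; apply: f0; rewrite inE ys orbT.
rewrite big_cons; have [xs|xs] := boolP (x \in s).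
  have -> : [set:: x :: s] = [set:: s].
    by apply/setP => y; rewrite !inE; case: eqP => // ->; rewrite xs.
  by rewrite -[leLHS]add0r lerD ?IH // f0 ?mem_head.
have -> : [set:: x :: s] = x |: [set:: s] by apply/setP => y; rewrite !inE.
by rewrite big_setU1 ?inE // lerD2l IH.
Qed.

Lemma root_path (chi : R) z :
  instance G -> is_eccentricity G chi -> z \in verts G ->
  exists P : {set E}, [/\ P \subset edges G, connect (adj G P) (rootv G) z &
    \sum_(e in P) cost G e <= chi].
Proof.
move=> hG [_ ecc] /ecc[d [[w [hw wz _] ->] _] dchi].
have wE := walk_edges hw.
exists [set:: unzip1 w]; split.
- by apply/subsetP => e; rewrite inE => /wE.
- rewrite -wz; apply: walk_connect; apply: walk_sub (hw) _ => e.
  by rewrite inE.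
- apply: le_trans dchi; apply: le_trans (sum_set_seq_le _) _.
    by move=> e /wE/(cost_gt0 hG)/ltW.
  by rewrite /unzip1 big_map.
Qed.

End SpanningTree.

(** * A cheap rooted subtree with a constant fraction of the prize *)

Section CheapSubtree.
Variables (R : realFieldType) (V E : finType) (G : graph R V E) (chi : R).
Hypotheses (hG : instance G) (hchi : is_eccentricity G chi).

Lemma sum_subset_le (T : finType) (f : T -> R) (A B : {set T}) :
  A \subset B -> (forall x, x \in B -> 0 <= f x) ->
  \sum_(x in A) f x <= \sum_(x in B) f x.
Proof.
move=> AB f0; rewrite [leRHS](big_setID A) /= (setIidPr AB) lerDl.
by apply: sumr_ge0 => x; rewrite inE => /andP[_ /f0].
Qed.

Lemma sum_setU_le (T : finType) (f : T -> R) (A B : {set T}) :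
  (forall x, x \in A -> 0 <= f x) ->
  \sum_(x in A :|: B) f x <= \sum_(x in A) f x + \sum_(x in B) f x.
Proof.
move=> f0; rewrite sum_setU_masked addrC lerD2r.
by apply: ler_sum => x /f0; case: ifP.
Qed.

Lemma eccentricity_ge0 : 0 <= chi.
Proof.
have [_ ecc] := hchi.
have [d [[w [hw _ _] ->] _]] := ecc _ (root_in hG).
apply: le_trans; rewrite big_seq; apply: sumr_ge0 => s sw.
apply/ltW/(cost_gt0 hG)/(walk_edges hw).
by apply/mapP; exists s.
Qed.

Lemma connect_anchors (Z : seq V) : {subset Z <= verts G} ->
  exists P : {set E}, [/\ P \subset edges G,
    forall z, z \in Z -> connect (adj G P) (rootv G) z &
    \sum_(e in P) cost G e <= (size Z)%:R * chi].
Proof.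
elim: Z => [|z Z IH] ZG.
  by exists set0; rewrite sub0set big_set0 mul0r.
have [|P [PE cP sP]] := IH; first by move=> y yZ; rewrite ZG // inE yZ orbT.
have [Q [QE cQ sQ]] := root_path hG hchi (ZG _ (mem_head _ _)).
exists (Q :|: P); split.
- by rewrite subUset QE.
- move=> y; rewrite inE => /predU1P[->|/cP].
    by apply: connect_adjS cQ; apply: subsetUl.
  by apply: connect_adjS; apply: subsetUr.
apply: le_trans (sum_setU_le _ _) _.
  by move=> e /(subsetP QE)/(cost_gt0 hG)/ltW.
by rewrite /= -natr1 mulrDl mul1r; lra.
Qed.

(** Up to [l] pieces of total cost at most a quarter of that of [T] are attached to the root by
    paths of cost at most [chi] each. A spanning tree of the root's component of this union is the
    desired subtree. *)
Lemma cheap_rooted_subtree (T : subgraph V E) (l : nat) :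
  rooted_subtree G T -> (0 < l)%N ->
  exists S, [/\ rooted_subtree G S,
    cost_of G S <= cost_of G T / 4 + l%:R * chi &
    (1 - (2 ^+ l)^-1) / 4 * prize_of G T <= prize_of G S].
Proof.
move=> [sT rT cT _] l0.
have [TV TE _] := sT.
have [F [hF uV VT uE ET]] := connected_forest sT rT cT.
set X := [set:: fedges F] in ET; set C := \sum_(e in X) cost G e.
have XE := subset_trans ET TE.
have cost0 e : e \in edges G -> 0 <= cost G e by move/(cost_gt0 hG)/ltW.
have CT : C <= cost_of G T.
  by apply: sum_subset_le => // e /(subsetP TE)/cost0.
have C0 : 0 <= C by apply: sumr_ge0 => e /(subsetP XE)/cost0.
have P0 : 0 <= prize_of G T.
  by apply: sumr_ge0 => v /(subsetP TV)/(prize_ge0 hG).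
have e0 : 0 < 2 ^+ l :> R by rewrite exprn_gt0.
have e2 : 0 < (2 ^+ l)^-1 :> R by rewrite invr_gt0.
have [Z [U [W [sZ [ZT UT WX] conn cW pU]]]] :
    exists Z (U : {set V}) (W : {set E}),
    [/\ (size Z <= l)%N,
        [/\ {subset Z <= T.1}, U \subset T.1 & W \subset X],
        forall u, u \in U -> exists2 y, y \in Z & connect (adj G W) y u,
        \sum_(e in W) cost G e <= C / 4 &
        (1 - (2 ^+ l)^-1) / 4 * prize_of G T <= \sum_(v in U) prize G v].
  (* For [C = 0] the bound of [dense_pieces] says nothing, but the whole tree is free: it is a
     single piece anchored at the root. *)
  have [Ce|Cn] := eqVneq C 0.
    exists [:: rootv G], T.1, X; split=> //.
    - by split=> // y; rewrite inE => /eqP->.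
    - move=> u; rewrite -VT inE => uF; exists (rootv G); rewrite ?mem_head //.
      exact: hangs_connect hF uF.
    - by rewrite -/C Ce mul0r lexx.
    rewrite -/(prize_of G T); have := mulr_ge0 (ltW e2) P0; lra.
  (* [dense_pieces] asks for nonnegative weights on the ambient types, while an instance controls
     them only inside the graph; hence the extension by zero. *)
  pose p v := if v \in T.1 then prize G v else 0.
  pose c e := if e \in X then cost G e else 0.
  have cE (W : {set E}) : W \subset X ->
      \sum_(e in W) c e = \sum_(e in W) cost G e.
    by move=> WX; apply: eq_bigr => e /(subsetP WX) eX; rewrite /c eX.
  have pE (U : {set V}) : U \subset T.1 ->
      \sum_(v in U) p v = \sum_(v in U) prize G v.
    by move=> UT; apply: eq_bigr => v /(subsetP UT) vT; rewrite /p vT.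
  have [||||Z [U [W [sZ [ZF [UF WF]] conn cW pU]]]] :=
    @dense_pieces _ _ _ G _ F hF uV uE l p c (C / 4).
  - move=> v; rewrite /p; case: ifP => // /(subsetP TV).
    exact: (prize_ge0 hG).
  - by move=> e; rewrite /c; case: ifP => // /(subsetP XE)/cost0.
  - by rewrite divr_ge0.
  - by rewrite cE // -/C; lra.
  have UT : U \subset T.1 by rewrite -VT.
  exists Z, U, W; split=> //.
  - by split=> // z; rewrite -VT inE => /ZF.
  - by rewrite -cE.
  rewrite VT !pE // cE // -/C -/(prize_of G T) in pU.
  have Cp : 0 < C by rewrite lt_def Cn.
  by rewrite -(ler_pM2l Cp); move: pU; lra.
have [P [PE cP sP]] := connect_anchors (fun z zZ => subsetP TV z (ZT z zZ)).
have AE : W :|: P \subset edges G by rewrite subUset PE (subset_trans WX XE).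
have [S [hS SV SE]] := spanning_rooted_subtree hG AE.
exists S; split=> //.
  apply: (@le_trans _ _ (\sum_(e in W :|: P) cost G e)).
    by apply: sum_subset_le => // e /(subsetP AE)/cost0.
  apply: le_trans (sum_setU_le _ _) _.
    by move=> e /(subsetP WX)/(subsetP XE)/cost0.
  have : (size Z)%:R * chi <= l%:R * chi.
    by rewrite ler_wpM2r ?eccentricity_ge0 // ler_nat.
  lra.
have [[SG _ _] _ _ _] := hS.
apply: le_trans pU _; apply: sum_subset_le.
  apply/subsetP => u /conn[y yZ yu]; rewrite SV inE.
  apply: (@connect_trans _ _ y).
    by apply: connect_adjS (cP y yZ); apply: subsetUr.
  by apply: connect_adjS yu; apply: subsetUl.
by move=> v /(subsetP SG)/(prize_ge0 hG).
Qed.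

End CheapSubtree.

(** * What skipping edges preserves, and what a greedy run spans *)

Section Algorithm.
Variables (R : realFieldType) (V E : finType) (G : graph R V E).
Implicit Types (A : {set E}) (K T : subgraph V E) (s pi : seq E).

Lemma spannedP A v :
  reflect (v = rootv G \/
           exists2 e, e \in A & v \in [set (ends G e).1; (ends G e).2])
    (v \in (spanned G A).1).
Proof.
rewrite !inE; apply: (iffP predU1P) => -[->|]; try by left.
  by move=> /bigcupP[e eA ve]; right; exists e.
by move=> [e eA ve]; right; apply/bigcupP; exists e.
Qed.

Lemma spannedS A A' :
  A \subset A' -> (spanned G A).1 \subset (spanned G A').1.
Proof.
move=> sA; apply/subsetP => v /spannedP vA; apply/spannedP.
case: vA => [->|[e eA ve]]; [by left | right].
by exists e => //; apply: subsetP eA.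
Qed.

Lemma spanned_edge A e x :
  e \in A -> x \in [set (ends G e).1; (ends G e).2] -> x \in (spanned G A).1.
Proof. by move=> eA xe; apply/spannedP; right; exists e. Qed.

Lemma walk_cat A x w1 w2 :
  walk G A x (w1 ++ w2) = walk G A x w1 && walk G A (walk_end x w1) w2.
Proof. by elim: w1 x => //= -[e y] w1 IH x; rewrite /= IH !andbA. Qed.

Lemma walk_end_cat x (w1 w2 : seq (E * V)) :
  walk_end x (w1 ++ w2) = walk_end (walk_end x w1) w2.
Proof. by rewrite /walk_end /unzip2 map_cat last_cat. Qed.

Lemma walk_ends_covered A x w v :
  walk G A x w -> w <> [::] -> v \in [set x; walk_end x w] ->
  exists2 e, e \in unzip1 w & v \in [set (ends G e).1; (ends G e).2].
Proof.
elim: w x => // -[e y] w IH x /= /and3P[_ je hw] _.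
have [vx|vx] := eqVneq v x.
  by exists e; rewrite ?mem_head // -(joins_endsE je) vx !inE eqxx.
rewrite !inE (negPf vx) /= => /eqP vw.
case: w IH hw vw => [_ _ ->|s w IH hw vw].
  by exists e; rewrite ?mem_head // -(joins_endsE je) !inE eqxx orbT.
have [//||f fw vf] := IH y hw; first by apply/set2P; right.
by exists f; rewrite // inE fw orbT.
Qed.

(* On a cycle other than a loop, each endpoint of [e] also lies on another
   edge of the cycle. *)
Lemma skipped_spans pi e x :
  skipped G pi e -> x \in (spanned G [set:: pi]).1 ->
  x \in [set (ends G e).1; (ends G e).2] ->
  [set (ends G e).1; (ends G e).2] \subset (spanned G [set:: pi]).1.
Proof.
move=> sk xpi xe; apply/subsetP => y ye.
case: sk => [epi|[f fpi pf]|[z [w [[_ hw wz uw _] ew]]]].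
- by apply: spanned_edge ye; rewrite inE.
- apply: (@spanned_edge _ f); first by rewrite inE.
  by rewrite (joins_endsE pf).
case/mapP: ew => -[e' b] /= ewb ee; move: ewb; rewrite -{e'}ee => ewb.
case/splitPr: w / ewb hw wz uw => w1 w2.
rewrite walk_cat walk_end_cat /= => /andP[hw1 /and3P[_ je hw2]] wz.
rewrite /unzip1 map_cat /= -/(unzip1 w1) -/(unzip1 w2).
rewrite uniq_catC /= mem_cat negb_or => /andP[/andP[ew2 ew1] _].
set u := walk_end z w1 in hw2 je wz.
have {}wz : walk_end b w2 = z by rewrite -wz.
have cover v w' a : walk G (e |: [set:: pi]) a w' -> e \notin unzip1 w' ->
    w' <> [::] -> v \in [set a; walk_end a w'] ->
    v \in (spanned G [set:: pi]).1.
  move=> hw' ew' wn vw; have [f fw vf] := walk_ends_covered hw' wn vw.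
  apply: spanned_edge vf; have := walk_edges hw' fw.
  by rewrite !inE => /predU1P[fe|//]; rewrite -fe fw in ew'.
rewrite -(joins_endsE je) in xe ye.
(* With both arcs empty the cycle is a loop, whose only end is [x]. With one empty, the other arc
   joins the two ends of [e]. Otherwise [w1] arrives at one end and [w2] leaves from the other. *)
have [w1n|/eqP w1n] := eqVneq w1 [::]; have [w2n|/eqP w2n] := eqVneq w2 [::].
- have ub : u = b by rewrite /u w1n -wz w2n.
  by move: xe ye xpi; rewrite ub !inE !orbb => /eqP-> /eqP->.
- have uz : u = z by rewrite /u w1n.
  by apply: (cover y w2 b) => //; rewrite wz -uz setUC.
- have bz : b = z by rewrite -wz w2n.
  by apply: (cover y w1 z) => //; rewrite -/u setUC -bz.
have /orP[/eqP->|/eqP->] : (y == u) || (y == b) by move: ye; rewrite !inE.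
  by apply: (cover u w1 z) => //; rewrite !inE eqxx orbT.
by apply: (cover b w2 b) => //; rewrite !inE eqxx.
Qed.

Lemma append_skipping_sub pi s pi' :
  append_skipping G pi s pi' -> {subset pi <= edges G} ->
  {subset s <= edges G} -> {subset pi' <= edges G}.
Proof.
elim=> // {}pi {}s {}pi' e _ _ IH hpi hs; apply: IH => f.
- exact: hpi.
- by move=> fs; rewrite hs // inE fs orbT.
- by rewrite mem_rcons inE => /predU1P[->|/hpi//]; rewrite hs // mem_head.
- by move=> fs; rewrite hs // inE fs orbT.
Qed.

Lemma append_skipping_prefix pi s pi' :
  append_skipping G pi s pi' -> exists t, pi' = pi ++ t.
Proof.
elim=> [{}pi|//|{}pi {}s {}pi' e _ _ [t ->]].
  by exists [::]; rewrite cats0.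
by exists (e :: t); rewrite cat_rcons.
Qed.

Lemma append_skipping_cost pi s pi' :
  append_skipping G pi s pi' -> (forall e, e \in s -> 0 <= cost G e) ->
  \sum_(e <- pi') cost G e
    <= \sum_(e <- pi) cost G e + \sum_(e <- s) cost G e.
Proof.
elim=> [{}pi|{}pi {}s {}pi' e _ _ IH|{}pi {}s {}pi' e _ _ IH] s0.
- by rewrite big_nil addr0.
- apply: le_trans (IH _) _.
    by move=> f fs; rewrite s0 // inE fs orbT.
  by rewrite big_cons; have := s0 e (mem_head _ _); lra.
- apply: le_trans (IH _) _.
    by move=> f fs; rewrite s0 // inE fs orbT.
  by rewrite big_rcons big_cons /=; lra.
Qed.

Lemma greedy_edges (H : graph R V E) K s :
  greedy_from H K s -> uniq s /\ {subset s <= edges H :\: K.2}.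
Proof.
elim=> {K s} [K _|K S e s _ [[[_ /subsetP SE _] _ _ _] _ _] eS _ _ [us sH]].
  by [].
have := SE e eS; rewrite !inE => eH; split=> [|f].
  by rewrite /= us andbT; apply/negP => /sH; rewrite !inE eqxx.
rewrite inE => /predU1P[->|/sH]; first by rewrite !inE.
by rewrite !inE negb_or => /andP[/andP[_ ->]].
Qed.

(** The invariant is that the output so far spans every vertex of the greedy tree [K]; by
    [skipped_spans] it survives skipped edges. When the greedy loop stops, no prize of [T] lies
    outside [K]. *)
Lemma append_greedy_spans T K s :
  instance G -> T.1 \subset verts G -> greedy_from (restrict G T) K s ->
  forall pi pi', append_skipping G pi s pi' ->
  K.1 \subset (spanned G [set:: pi]).1 ->
  forall v, v \in T.1 -> 0 < prize G v -> v \in (spanned G [set:: pi']).1.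
Proof.
move=> hG TV.
elim=> {K s} [K tot0|K S e s _ _ _ inc _ IH] pi pi' app Kpi v vT pv.
  have -> : pi' = pi by inversion app.
  have [vK|vK] := boolP (v \in K.1); first exact: subsetP vK.
  have [->|vr] := eqVneq v (rootv G); first by apply/spannedP; left.
  have /psumr_eq0P/(_ v) := tot0.
  rewrite /= !inE (negPf vr) vK vT /= => h.
  rewrite h ?ltxx // in pv => u; case: ifP => // ur.
  by rewrite !inE ur /= => /andP[_ /(subsetP TV)/(prize_ge0 hG)].
(* An edge at the contracted root has an end that lies in [K] or is the root itself, so this end is
   already spanned. *)
have [x xpi xe] : exists2 x, x \in (spanned G [set:: pi]).1 &
    x \in [set (ends G e).1; (ends G e).2].
  have fP x : (if x \in K.1 then rootv G else x) == rootv G ->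
      x \in (spanned G [set:: pi]).1.
    case: ifP => [xK _|_ /eqP->]; first exact: subsetP xK.
    by apply/spannedP; left.
  case/orP: inc => /fP xpi.
    by exists (ends G e).1; rewrite // !inE eqxx.
  by exists (ends G e).2; rewrite // !inE eqxx orbT.
inversion app as [|? ? ? ? sk app'|? ? ? ? sk app']; subst.
  apply: (IH _ _ app') => //=.
  by rewrite subUset Kpi andbT; apply: skipped_spans xe.
apply: (IH _ _ app') => //=; rewrite subUset; apply/andP; split.
  apply/subsetP => y; apply: spanned_edge.
  by rewrite inE mem_rcons mem_head.
apply: subset_trans Kpi _; apply: spannedS; apply/subsetP => f.
by rewrite !inE mem_rcons inE => ->; rewrite orbT.
Qed.

End Algorithm.

(** * Costs of the phases and the competitive ratio *)

Section Competitiveness.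
Variables (R : realFieldType) (V E : finType) (G : graph R V E).
Hypothesis hG : instance G.
Implicit Types (T : subgraph V E) (s pi : seq E).

(** Only positive prizes are demanded, since a greedy run may stop before reaching vertices of prize
    0. *)
Definition spans_prizes_of T (A : {set E}) : Prop :=
  forall v, v \in T.1 -> 0 < prize G v -> v \in (spanned G A).1.

(** The greedy run outputs distinct edges of [T], so a phase adds at most the cost of [T], and
    skipping only lowers it. *)
Lemma greedy_phase (b : R) T s pi pi' :
  is_opt G b T -> density_greedy (restrict G T) s ->
  append_skipping G pi s pi' -> {subset pi <= edges G} ->
  [/\ {subset pi' <= edges G}, spans_prizes_of T [set:: pi'],
      \sum_(e <- pi') cost G e <= \sum_(e <- pi) cost G e + b &
      exists t, pi' = pi ++ t].
Proof.
move=> [[[TV /subsetP TE _] _ _ _] Tb _] gr app piG.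
have [us sT] := greedy_edges gr.
have sTE : {subset s <= T.2} by move=> e /sT; rewrite !inE.
have sG : {subset s <= edges G} by move=> e /sTE/TE.
split; last exact: append_skipping_prefix app.
- exact: append_skipping_sub app piG sG.
- apply: append_greedy_spans hG TV gr _ _ app _.
  by apply/subsetP => v; rewrite !inE => ->.
apply: le_trans (append_skipping_cost app _) _.
  by move=> e /sG/(cost_gt0 hG)/ltW.
rewrite lerD2l; apply: le_trans Tb; rewrite sum_uniq_set //.
apply: sum_subset_le; first by apply/subsetP => e; rewrite inE => /sTE.
by move=> e /TE/(cost_gt0 hG)/ltW.
Qed.

Lemma scaling_edges (chi : R) i pi out :
  scaling_from G chi i pi out -> {subset pi <= edges G} ->
  {subset out <= edges G}.
Proof.
elim=> // {}i {}pi s pi' {}out T _ optT gr app _ IH piG.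
by have [/IH] := greedy_phase optT gr app piG.
Qed.

Lemma scaling_extends (chi : R) i pi out :
  scaling_from G chi i pi out -> exists t, out = pi ++ t.
Proof.
elim=> [? ?|? ? ? ? ? ? _ _ _ /append_skipping_prefix[t1 ->] _ [t2 ->]].
  by exists [::]; rewrite cats0.
by exists (t1 ++ t2); rewrite catA.
Qed.

(** The loop is followed to the first [i] with [N < 2 ^+ i.+1 * chi], unless it ends earlier. The
    phases before [i] cost at most [(2 ^+ i - 1) * chi], hence at most [N - chi], and the last of
    them, [j = i - 1], has spanned the prizes of its optimal tree. *)
Lemma scaling_prefix (chi N : R) i pi out :
  scaling_from G chi i pi out -> 2 * chi <= N ->
  {subset pi <= edges G} -> \sum_(e <- pi) cost G e <= (2 ^+ i - 1) * chi ->
  2 ^+ i * chi <= N ->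
  i = 0 \/ (exists2 T, is_opt G (2 ^+ i.-1 * chi) T &
            spans_prizes_of T [set:: pi]) ->
  exists pi1 t, [/\ out = pi1 ++ t, {subset pi1 <= edges G},
    \sum_(e <- pi1) cost G e <= N - chi &
    spans_prizes G pi1 \/
    exists j T, [/\ is_opt G (2 ^+ j * chi) T, spans_prizes_of T [set:: pi1] &
                    N < 2 ^+ j.+2 * chi]].
Proof.
move=> + hN; elim=> {i pi out} [i pi sp|i pi s pi' out T _ optT gr app sc IH]
  piG cpi iN prev.
  by exists pi, [::]; rewrite cats0; split; [| |lra|left].
have [piG' spT cpi' [t' epi']] := greedy_phase optT gr app piG.
have [iN'|Ni] := leP (2 ^+ i.+1 * chi) N.
  apply: IH => //; last by right; exists T.
  by rewrite exprS; lra.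
have [t et] : exists t, out = pi ++ t.
  have [t ->] := scaling_extends sc.
  by exists (t' ++ t); rewrite epi' catA.
exists pi, t; split=> //; first by lra.
(* The case [i = 0], with no completed phase, contradicts [2 * chi <= N]. *)
right; case: i prev {IH gr app sc cpi cpi' iN optT} Ni => [|j] prev Ni.
  by move: Ni; rewrite expr1; lra.
case: prev => // -[T' optT' spT'].
by exists j, T'.
Qed.

(** Costs are nonnegative, so each edge of [pi] is reached at an accumulated cost no larger than
    that of the whole of [pi]. *)
Lemma alg_prefix (b : R) pi t :
  {subset pi <= edges G} -> \sum_(e <- pi) cost G e <= b ->
  [set:: pi] \subset (alg G (pi ++ t) b).2.
Proof.
move=> piG cpi; apply/subsetP => e; rewrite inE => epi.
have hi : (index e pi < size (pi ++ t))%N.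
  by rewrite size_cat ltn_addr // index_mem.
apply/imsetP; exists (Ordinal hi); last first.
  by rewrite (tnth_nth e) /= nth_cat index_mem epi nth_index.
rewrite inE; apply: le_trans cpi.
rewrite (eq_bigr (fun j : 'I__ => cost G (nth e (pi ++ t) j))); last first.
  by move=> j _; rewrite (tnth_nth e).
rewrite -(big_mkord (fun j => (j <= index e pi)%N)
  (fun j => cost G (nth e (pi ++ t) j))).
rewrite (@big_cat_nat _ _ _ (size pi)) //=; last by rewrite size_cat leq_addr.
rewrite [X in _ + X]big_nat_cond [X in _ + X]big1 ?addr0; last first.
  move=> j /andP[/andP[h1 _] h2]; have := leq_ltn_trans h2 _.
  by move/(_ (size pi)); rewrite index_mem epi ltnNge h1 => /(_ isT).
rewrite (big_nth e) big_mkcond big_nat_cond [leRHS]big_nat_cond.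
apply: ler_sum => j; rewrite andbT => /= jpi; rewrite nth_cat jpi.
by case: ifP => // _; apply/ltW/(cost_gt0 hG)/piG/mem_nth.
Qed.

Lemma prize_le_spanned T (A : {set E}) :
  T.1 \subset verts G -> A \subset edges G -> spans_prizes_of T A ->
  prize_of G T <= prize_of G (spanned G A).
Proof.
move=> /subsetP TV /subsetP AE hA.
have AV v : v \in (spanned G A).1 -> v \in verts G.
  move=> /spannedP[->|[e /AE/(ends_in hG)[e1 e2]]]; first exact: root_in.
  by rewrite !inE => /orP[]/eqP->.
rewrite /prize_of (bigID (fun v => 0 < prize G v)) /= [X in _ + X]big1 ?addr0.
  have -> : \sum_(v in T.1 | 0 < prize G v) prize G v
            = \sum_(v in [set v in T.1 | 0 < prize G v]) prize G v.
    by apply: eq_bigl => v; rewrite inE.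
  apply: sum_subset_le.
    by apply/subsetP => v; rewrite inE => /andP[/hA]; apply.
  by move=> v /AV/(prize_ge0 hG).
move=> v /andP[/TV/(prize_ge0 hG) v0]; rewrite -leNgt => ?.
by apply/eqP; rewrite eq_le v0 andbT.
Qed.

End Competitiveness.

Theorem theorem6 (R : realFieldType) (V E : finType) (G : graph R V E)
    (hG : instance G) (chi : R) (hchi : is_eccentricity G chi)
    (l : nat) (hl : (1 <= l)%N)
    (pi : seq E) (hpi : capacity_scaling G chi pi)
    (B : R) (hB : 0 <= B) (T : subgraph V E) (hT : is_opt G B T) :
  2 ^+ (l + 2) / (2 ^+ l - 1) *
    prize_of G (alg G pi (B + (4 * l%:R - 1) * chi)) >= prize_of G T.
Proof.
have chi0 := eccentricity_ge0 hG hchi.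
have l1 : 1 <= l%:R :> R by rewrite ler1n.
set N := B + 4 * l%:R * chi.
have lchi : chi <= l%:R * chi by rewrite ler_peMl.
have -> : B + (4 * l%:R - 1) * chi = N - chi by rewrite /N; lra.
have sub0 : {subset [::] <= edges G} by [].
have [||||pi1 [t [epi pi1G cpi1 sp]]] := scaling_prefix (N := N) hG hpi _ sub0.
- by rewrite /N; lra.
- by rewrite big_nil expr0; lra.
- by rewrite expr0 /N; lra.
- by left.
set b := N - chi in cpi1 *.
have algG : (alg G pi b).2 \subset edges G.
  apply/subsetP => e /imsetP[i _ ->].
  by apply: (scaling_edges hG hpi sub0); apply: mem_tnth.
have pi1alg : [set:: pi1] \subset (alg G pi b).2.
  by rewrite epi; apply: alg_prefix.
have alg_ge T' : rooted_subtree G T' -> spans_prizes_of G T' [set:: pi1] ->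
    prize_of G T' <= prize_of G (alg G pi b).
  move=> [[T'V _ _] _ _ _] spT'; apply: prize_le_spanned => // v vT' pv.
  exact: subsetP (spannedS _ pi1alg) _ (spT' v vT' pv).
have e1 : 2 <= 2 ^+ l :> R by rewrite -[leLHS]expr1 ler_eXn2l ?ltr1n.
have e0 : 0 < 2 ^+ l - 1 :> R by lra.
have [rT cT _] := hT.
(* The factor is the reciprocal of the claimed ratio. *)
suff key : (1 - (2 ^+ l)^-1) / 4 * prize_of G T <= prize_of G (alg G pi b).
  rewrite mulrAC ler_pdivlMr // exprD.
  have c0 : 0 <= 4 * 2 ^+ l :> R by lra.
  have := ler_wpM2l c0 key.
  have -> : 4 * 2 ^+ l * ((1 - (2 ^+ l)^-1) / 4 * prize_of G T)
            = (2 ^+ l - 1) * prize_of G T by field; lra.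
  lra.
have T0 : 0 <= prize_of G T.
  case: rT => -[/subsetP TV _ _] _ _ _.
  by apply: sumr_ge0 => v /TV/(prize_ge0 hG).
case: sp => [sp|[j [Tj [optTj spTj NTj]]]].
  have le1 : (1 - (2 ^+ l)^-1) / 4 <= 1 :> R.
    have : 0 <= (2 ^+ l)^-1 :> R by rewrite invr_ge0; lra.
    lra.
  apply: (@le_trans _ _ (prize_of G T)); first by rewrite ler_piMl.
  apply: alg_ge => // v vT pv; apply: (subsetP sp).
  by rewrite inE pv andbT; case: rT => -[/subsetP TV _ _] _ _ _; apply: TV.
have [S [rS cS pS]] := cheap_rooted_subtree hG hchi rT hl.
apply: le_trans pS _; have [rTj _ maxTj] := optTj.
apply: le_trans (maxTj S rS _) (alg_ge Tj rTj spTj).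
(* The cost of [S] is at most [B / 4 + l%:R * chi = N / 4], which is below the budget [2 ^+ j * chi]
   of [Tj]. *)
by apply: le_trans cS _; move: NTj; rewrite /N !exprS; lra.
Qed.
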